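(* The circulant graphs $C_{16}(1,2,7)$ and $C_{16}(2,3,5)$ are Type-2 isomorphic with respect to $m=2$.
   Context: Circulant graph: for $n\in\mathbb{N}$ and a set $R\subseteq\{1,\dots,\lfloor n/2\rfloor\}$ of jump sizes, $C_n(R)$ is the graph with vertex set $\mathbb{Z}_n$ (vertex $i$ also written $v_i$) in which $i$ is adjacent to $i\pm r$ (mod $n$) for each $r\in R$. For $R=\{r_1,\dots,r_k\}$ one also writes $C_n(r_1,\dots,r_k)$. Reflexive modulo $n$: for $y\in\mathbb{Z}$, $yR$ computed under reflexive modulo $n$ is the set obtained by reducing each $yr$ ($r\in R$) modulo $n$ and replacing any residue $r'>n/2$ by $n-r'$. Let $\varphi_n=\{y\in\mathbb{Z}_n:\gcd(n,y)=1\}$. The map $\theta_{n,m,t}$: for a divisor $m>1$ of $n$ and $0\le t\le \frac nm-1$, $\theta_{n,m,t}:\mathbb{Z}_n\to\mathbb{Z}_n$ is $\theta_{n,m,t}(x)=x+jtm \pmod n$, where $x=qm+j$, $0\le j\le m-1$, $0\le q\le \frac nm-1$. The graph $\theta_{n,m,t}(C_n(R))$ has vertex set $\mathbb{Z}_n$ and edges $\{\theta_{n,m,t}(x),\theta_{n,m,t}(x+s)\}$ for $x\in\mathbb{Z}_n$, $s\in R$. Equality of graphs means equality as labelled graphs on $\mathbb{Z}_n$. Type-2 isomorphism with respect to $m$: let $|R|\ge 3$, $r\in R$, $m>1$, $m\mid\gcd(n,r)$ and $m^3\mid n$. If for some $t$ with $0\le t\le\frac nm-1$ one has $\theta_{n,m,t}(C_n(R))=C_n(S)$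 for some $S$, and $S\ne yR$ (under reflexive modulo $n$) for all $y\in\varphi_n$, then $C_n(R)$ and $C_n(S)$ are called Type-2 isomorphic with respect to $m$. *)

(* Defs.v *)
From mathcomp Require Import all_boot all_order all_algebra finmap.

Set Implicit Arguments.
Unset Strict Implicit.
Unset Printing Implicit Defensive.

Local Open Scope nat_scope.

(* Z_n is 'I_n for every n ('Z_n would be wrong for n < 2), and a (labelled)
   graph with vertex set Z_n is given by its set of edges {i, j}; equality of
   labelled graphs is then equality of edge sets. *)
Definition zgraph (n : nat) := {set {set 'I_n}}.

(* The residue of k modulo n; the vertex x only witnesses 0 < n. *)
Definition zmod_of (n : nat) (x : 'I_n) (k : nat) : 'I_n :=
  Ordinal (ltn_pmod k (leq_ltn_trans (leq0n x) (ltn_ord x))).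

Definition jump_set (n : nat) (R : {fset nat}) : Prop :=
  forall r, r \in R -> 1 <= r <= n %/ 2.

(* The second disjunct says j = i - r in Z_n. *)
Definition circ_adj (n : nat) (R : {fset nat}) (i j : 'I_n) : bool :=
  [exists r : R, (j == i + val r %[mod n]) || (j + val r == i %[mod n])].

Definition circulant (n : nat) (R : {fset nat}) : zgraph n :=
  [set [set i; j] | i in [set: 'I_n], j in [set: 'I_n] & circ_adj R i j].

(* x = q m + j with j = x %% m. *)
Definition theta (n m t : nat) (x : 'I_n) : 'I_n :=
  zmod_of x (x + (x %% m) * t * m).

Definition theta_circulant (n m t : nat) (R : {fset nat}) : zgraph n :=
  [set [set theta m t x; theta m t (zmod_of x (x + val s))]
     | x : 'I_n, s : R].

Definition reflexive_mod (n : nat) (z : int) : nat :=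
  let r := `|(z %% n%:Z)%Z|%N in if n < 2 * r then n - r else r.

Definition reflexive_mul (n : nat) (y : int) (R : {fset nat}) : {fset nat} :=
  [fset reflexive_mod n (y * r%:Z)%R | r in R]%fset.

Definition type2_isomorphic (n m : nat) (R S : {fset nat}) : Prop :=
  [/\ jump_set n R /\ jump_set n S,
      3 <= #|` R|%fset,
      1 < m /\ (exists2 r, r \in R & m %| gcdn n r),
      m ^ 3 %| n &
      (exists2 t, t < n %/ m & theta_circulant n m t R = circulant n S) /\
      (forall y : 'I_n, coprime n y -> S <> reflexive_mul n (Posz y) R)].

(* Main.v *)
Require Import Defs.
From mathcomp Require Import all_boot ssrint finmap.

(* Modulo 16 the edges of [C_16(1,2,7)] of odd jump join an even [x] to
   [x + {1, 7, 9, 15}].  The map [theta] with [t = 2] fixes the even vertices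
   and adds 4 to the odd ones, so these become [x + {5, 11, 13, 3}], the odd
   jumps of [C_16(2,3,5)], while the edges of jump 2 are preserved.  On the
   other hand a unit [y] modulo 16 with [2] in [yR] satisfies
   [y = 1] or [7 (mod 8)], and then [3] is not in [yR]. *)

Set Implicit Arguments.
Unset Strict Implicit.
Unset Printing Implicit Defensive.

(** Edges are unordered, so a backward jump from [i] to [j] is a forward jump from [j]; one
    orientation suffices. *)
Lemma circulantP (n : nat) (R : {fset nat}) (e : {set 'I_n}) :
  reflect (exists (i : 'I_n) (r : nat),
             r \in R /\ e = [set i; zmod_of i (i + r)])
          (e \in circulant n R).
Proof.
apply: (iffP imset2P) => [[i j _]|[i [r [rR ->]]]].
  rewrite !inE => /existsP[r /orP[/eqP ij|/eqP ji]] ->.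
    exists i, (val r); split; first exact: valP.
    by congr [set i; _]; apply: val_inj; rewrite /= -ij modn_small.
  exists j, (val r); split; first exact: valP.
  by rewrite setUC; congr [set j; _]; apply: val_inj; rewrite /= ji modn_small.
exists i (zmod_of i (i + r)); rewrite ?inE //.
by apply/existsP; exists [` rR]%fset; rewrite /= modn_mod eqxx.
Qed.

Lemma theta_circulantP (n m t : nat) (R : {fset nat}) (e : {set 'I_n}) :
  reflect (exists (x : 'I_n) (s : nat),
             s \in R /\ e = [set theta m t x; theta m t (zmod_of x (x + s))])
          (e \in theta_circulant n m t R).
Proof.
apply: (iffP imset2P) => [[x s _ _ ->]|[x [s [sR ->]]]].
  by exists x, (val s); split; first exact: valP.
by exists x [` sR]%fset.
Qed.

(** Unordered pairs of plain naturals, unlike sets over ['I_16], can be compared by [vm_compute]. *)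
Definition same_pair (p q : nat * nat) : bool :=
  (p == q) || (p == (q.2, q.1)).

Lemma same_pair_set2 (n : nat) (a b c d : 'I_n) :
  same_pair (val a, val b) (val c, val d) -> [set a; b] = [set c; d].
Proof.
by case/orP=> /eqP[/val_inj-> /val_inj->] //; rewrite setUC.
Qed.

Definition edge16 (i r : nat) : nat * nat := (i, (i + r) %% 16).

Definition theta_edge16 (x s : nat) : nat * nat :=
  let th y := (y + y %% 2 * 2 * 2) %% 16 in (th x, th ((x + s) %% 16)).

Lemma theta_edge16_sub :
  all (fun x => all (fun s =>
    has (fun i => has (fun r => same_pair (theta_edge16 x s) (edge16 i r))
      [:: 2; 3; 5]) (iota 0 16)) [:: 1; 2; 7]) (iota 0 16).
Proof. by vm_compute. Qed.

(** With [theta_edge16_sub], this gives the two inclusions between the edge sets. *)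
Lemma edge16_sub :
  all (fun i => all (fun r =>
    has (fun x => has (fun s => same_pair (edge16 i r) (theta_edge16 x s))
      [:: 1; 2; 7]) (iota 0 16)) [:: 2; 3; 5]) (iota 0 16).
Proof. by vm_compute. Qed.

Lemma in_fset3 (a b c x : nat) :
  (x \in [fset a; b; c]%fset) = (x \in [:: a; b; c]).
Proof. by rewrite !inE orbA. Qed.

Lemma theta_C16_127 :
  theta_circulant 16 2 2 [fset 1; 2; 7]%fset = circulant 16 [fset 2; 3; 5]%fset.
Proof.
have in16 (x : 'I_16) : val x \in iota 0 16 by rewrite mem_iota ltn_ord.
apply/setP=> e; apply/theta_circulantP/circulantP => -[x [s []]];
  rewrite in_fset3 => sR ->.
- have /hasP[i] := allP (allP theta_edge16_sub _ (in16 x)) _ sR.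
  rewrite mem_iota add0n => i16 /hasP[r rS eq_e].
  exists (Ordinal i16), r; rewrite in_fset3; split=> //.
  exact: same_pair_set2.
- have /hasP[i] := allP (allP edge16_sub _ (in16 x)) _ sR.
  rewrite mem_iota add0n => i16 /hasP[r rS eq_e].
  exists (Ordinal i16), r; rewrite in_fset3; split=> //.
  exact: same_pair_set2.
Qed.

Lemma reflexive_mul_127_neq (y : 'I_16) : coprime 16 y ->
  [fset 2; 3; 5]%fset <> reflexive_mul 16 (Posz y) [fset 1; 2; 7]%fset.
Proof.
move=> cop_y eqS.
(* Only the inclusion of S in yR is needed for the contradiction. The product can be taken in [nat],
   as it is convertible to the one in [int]. *)
have inS z : z \in [:: 2; 3; 5] ->
    z \in map (fun r : nat => reflexive_mod 16 (y * r)%N) [:: 1; 2; 7].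
  rewrite -in_fset3 eqS => /imfsetP[r rR ->].
  by apply/mapP; exists r; first by rewrite -in_fset3.
have: all (mem (map (fun r : nat => reflexive_mod 16 (y * r)%N) [:: 1; 2; 7]))
   [:: 2; 3; 5] by apply/allP.
(* For each residue, either [cop_y] or the inclusion computes to false; [lt_y] excludes values from
   16 on. *)
by case: y cop_y {eqS inS} => y lt_y; do 16?[case: y lt_y => [|y] lt_y].
Qed.

Theorem mainTheorem1 :
  type2_isomorphic 16 2 [fset 1; 2; 7]%fset [fset 2; 3; 5]%fset.
Proof.
split=> //.
- by split=> r; rewrite in_fset3 !inE => /or3P[] /eqP->.
(* The notation puts the last singleton on the right of the union; [cardfsU1] expects it on the
   left. *)
- by rewrite fsetUC !cardfsU1 cardfs1 !inE.
- by split=> //; exists 2; rewrite // in_fset3.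
- split; last exact: reflexive_mul_127_neq.
  by exists 2; last exact: theta_C16_127.
Qed.
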